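(* Let $X_1$ be an $FPA_\lambda(n_1,a)$ of size $N_1$ and let $X_2$ be an $FPA_\lambda(n_2,b)$ of size $N_2$. Then there exists an $FPA_\lambda(n_1+n_2, \min(a,b))$ of size $N_1N_2$. In particular, for even $n$ (divisible by $\lambda$), given two $FPA_\lambda(n,\frac{n}{2})$'s, of sizes $N_1$ and $N_2$ respectively, there exists an $FPA_\lambda(2n,\frac{n}{2})$ of size $N_1N_2$, so that \[ M_\lambda\left(2n,\tfrac{n}{2}\right) \geq M_\lambda\left(n,\tfrac{n}{2}\right)^2. \]
   Context: A $\lambda$-permutation of length $n$ (where the positive integer $\lambda$ divides $n$) is an arrangement (sequence of length $n$) of the multiset consisting of $n/\lambda$ distinct symbols, each repeated exactly $\lambda$ times. The distance between two $\lambda$-permutations is the Hamming distance, i.e. the number of positions in which they disagree. A frequency permutation array $FPA_\lambda(n,d)$ is a set $T$ of $\lambda$-permutations of length $n$ (on a common set of $n/\lambda$ symbols) such that any two distinct members of $T$ have distance at least $d$; its size is $|T|$. $M_\lambda(n,d)$ denotes the maximum size of an $FPA_\lambda(n,d)$. *)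

(* Defs.v *)
From mathcomp Require Import all_boot.

Set Implicit Arguments.
Unset Strict Implicit.
Unset Printing Implicit Defensive.

Section FPA.

Variables (S : finType) (n : nat).

Definition lam_perm (lam : nat) (t : n.-tuple S) : bool :=
  [forall s : S, count_mem s t == lam].

Definition hamming (t u : n.-tuple S) : nat :=
  #|[set i : 'I_n | tnth t i != tnth u i]|.

(* [S] is the common symbol set.  For 0 < lam, the conditions lam %| n and
   #|S| = n %/ lam follow from the existence of a lam-permutation; they are
   required here so that they also hold for the empty array. *)
Definition FPA (lam d : nat) (X : {set n.-tuple S}) : bool :=
  [&& 0 < lam, lam %| n, #|S| == n %/ lam,
      [forall t in X, lam_perm lam t] &
      [forall t in X, forall u in X, (t != u) ==> (d <= hamming t u)]].

End FPA.

(* The maximum is over arrays on the symbols 'I_(n %/ lam); by [FPA_leq_M] it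
   bounds the size of arrays on any symbol set.  It is 0 (maximum over no
   array) unless lam is positive and divides n. *)
Definition M (lam n d : nat) : nat :=
  \max_(X : {set n.-tuple 'I_(n %/ lam)} | FPA lam d X) #|X|.

Lemma FPA_leq_M (S : finType) (lam n d : nat) (X : {set n.-tuple S}) :
  FPA lam d X -> #|X| <= M lam n d.
Proof.
move=> /and5P[lam0 lamn /eqP cS /forall_inP Xp /forall_inP Xd].
pose f (s : S) : 'I_(n %/ lam) := cast_ord cS (enum_rank s).
have fI : injective f by move=> s t /cast_ord_inj /enum_rank_inj.
have fS r : exists s, f s = r.
  by exists (enum_val (cast_ord (esym cS) r)); rewrite /f enum_valK cast_ordKV.
pose F (t : n.-tuple S) := [tuple of map f t].
have FI : injective F.
  by move=> t u /(congr1 val) /= /(inj_map fI) /val_inj.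
rewrite -(card_imset X FI) /M.
apply: (@leq_bigmax_cond _ _ (fun Y : {set n.-tuple 'I_(n %/ lam)} => #|Y|)).
apply/and5P; split; rewrite ?card_ord //.
  apply/forall_inP => _ /imsetP[t tX ->]; apply/forallP => r.
  have [s <-] := fS r; rewrite count_map.
  have /forallP/(_ s) := Xp t tX; congr (_ == _).
  by apply/eq_count => x /=; rewrite (inj_eq fI).
apply/forall_inP => _ /imsetP[t tX ->].
apply/forall_inP => _ /imsetP[u uX ->]; rewrite (inj_eq FI).
have /forall_inP/(_ u uX)/implyP tu := Xd t tX.
apply/implyP => /tu /leq_trans; apply; rewrite /hamming.
apply/subset_leq_card/subsetP => i.
by rewrite !inE !tnth_map (inj_eq fI).
Qed.

Lemma M_attained (lam n d : nat) : 0 < lam -> lam %| n ->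
  exists2 X : {set n.-tuple 'I_(n %/ lam)}, FPA lam d X & #|X| = M lam n d.
Proof.
move=> lam0 lamn.
have F0 : FPA lam d (set0 : {set n.-tuple 'I_(n %/ lam)}).
  apply/and5P; split; rewrite ?card_ord //.
    by apply/forall_inP => t; rewrite inE.
  by apply/forall_inP => t; rewrite inE.
exists [arg max_(X > set0 | FPA lam d X) #|X|]; first by case: arg_maxnP.
by rewrite /M (bigmax_eq_arg _ F0).
Qed.

(* Main.v *)
(* Relabel the two arrays over disjoint symbol sets and take all concatenations
   of a word of the first with a word of the second.  Hamming distances add
   under concatenation, and two distinct concatenations differ in at least one
   of their halves. *)
Require Import Defs.
From mathcomp Require Import all_boot.

(** Written as a sum, the distance can be split at the boundary of a concatenation and compared
    position by position. *)
Lemma hamming_sum (S : finType) (n : nat) (t u : n.-tuple S) :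
  hamming t u = \sum_(i < n) (tnth t i != tnth u i).
Proof. by rewrite /hamming -sum1dep_card big_mkcond. Qed.

Lemma hamming_cat (S : finType) (m n : nat) (t t' : m.-tuple S)
    (u u' : n.-tuple S) :
  hamming [tuple of t ++ u] [tuple of t' ++ u'] = hamming t t' + hamming u u'.
Proof.
rewrite !hamming_sum big_split_ord /=.
by congr (_ + _); apply: eq_bigr => i _; rewrite ?tnth_lshift ?tnth_rshift.
Qed.

Lemma hamming_map (S S' : finType) (f : S -> S') (n : nat) (t u : n.-tuple S) :
  injective f -> hamming (map_tuple f t) (map_tuple f u) = hamming t u.
Proof.
by move=> fI; rewrite !hamming_sum; apply: eq_bigr => i _;
  rewrite !tnth_map (inj_eq fI).
Qed.

(** The sum type keeps the two alphabets disjoint even when [S1] and [S2] coincide. *)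
Definition sum_cat {S1 S2 : finType} {n1 n2 : nat}
    (p : n1.-tuple S1 * n2.-tuple S2) : (n1 + n2).-tuple (S1 + S2)%type :=
  [tuple of map_tuple inl p.1 ++ map_tuple inr p.2].

Section SumCat.

Context {S1 S2 : finType} {n1 n2 : nat}.
Implicit Types p q : n1.-tuple S1 * n2.-tuple S2.

(** Both first halves have length [n1], so equal concatenations are cut at the same place, and
    relabelling by an injection is undone on each half. *)
Lemma sum_cat_inj : injective (@sum_cat S1 S2 n1 n2).
Proof.
move=> [t u] [t' u'] /(congr1 val) /eqP /=.
rewrite eqseq_cat ?size_map ?size_tuple // => /andP[/eqP tE /eqP uE].
have inlI : injective (@inl S1 S2) by move=> ? ? [].
have inrI : injective (@inr S1 S2) by move=> ? ? [].
by congr (_, _); apply: val_inj; [exact: inj_map inlI _ _ tE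
                                 | exact: inj_map inrI _ _ uE].
Qed.

Lemma hamming_sum_cat p q :
  hamming (sum_cat p) (sum_cat q) = hamming p.1 q.1 + hamming p.2 q.2.
Proof. by rewrite hamming_cat !hamming_map // => ? ? []. Qed.

(** A symbol tagged [inl] or [inr] can occur in one half only: that half supplies its [lam]
    occurrences and the other supplies none. *)
Lemma lam_perm_sum_cat lam p :
  lam_perm lam p.1 -> lam_perm lam p.2 -> lam_perm lam (sum_cat p).
Proof.
move=> /forallP tP /forallP uP; apply/forallP => -[] s;
  rewrite count_cat !count_map.
- by rewrite (eq_count (a2 := pred1 s)) // [X in _ + X](eq_count (a2 := pred0)) //
    count_pred0 addn0 tP.
- by rewrite (eq_count (a2 := pred0)) // count_pred0 (eq_count (a2 := pred1 s)) // uP.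
Qed.

Lemma FPA_sum_cat lam a b (X1 : {set n1.-tuple S1}) (X2 : {set n2.-tuple S2}) :
  FPA lam a X1 -> FPA lam b X2 ->
  FPA lam (minn a b) (sum_cat @: setX X1 X2).
Proof.
move=> /and5P[lam0 dv1 /eqP c1 /forall_inP p1 /forall_inP d1].
move=> /and5P[_ dv2 /eqP c2 /forall_inP p2 /forall_inP d2].
apply/and5P; split=> //; first exact: dvdn_add.
(* The alphabet has the required size because the quotients add up when [lam] divides [n1]. *)
- by rewrite card_sum c1 c2 divnDl.
- apply/forall_inP => _ /imsetP[[t u] /setXP[/= tX uX] ->].
  by apply: lam_perm_sum_cat; [exact: p1 | exact: p2].
apply/forall_inP => _ /imsetP[[t u] /setXP[/= tX uX] ->].
apply/forall_inP => _ /imsetP[[t' u'] /setXP[/= tX' uX'] ->].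
rewrite (inj_eq sum_cat_inj) hamming_sum_cat xpair_eqE negb_and /=.
(* Only one half is known to differ; its distance alone reaches [a] or [b], hence the minimum. *)
apply/implyP => /orP[tt' | uu'].
- have /forall_inP/(_ t' tX')/implyP/(_ tt') le_a := d1 t tX.
  by rewrite geq_min (leq_trans le_a) ?leq_addr.
- have /forall_inP/(_ u' uX')/implyP/(_ uu') le_b := d2 u uX.
  by rewrite geq_min (leq_trans le_b) ?leq_addl ?orbT.
Qed.

Lemma card_sum_cat (X1 : {set n1.-tuple S1}) (X2 : {set n2.-tuple S2}) :
  #|sum_cat @: setX X1 X2| = #|X1| * #|X2|.
Proof. by rewrite (card_imset _ sum_cat_inj) cardsX. Qed.

End SumCat.

Theorem proposition4p5 (lam : nat) (lam_gt0 : 0 < lam) :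
  (forall (n1 n2 a b N1 N2 : nat) (S1 S2 : finType)
      (X1 : {set n1.-tuple S1}) (X2 : {set n2.-tuple S2}),
    FPA lam a X1 -> #|X1| = N1 ->
    FPA lam b X2 -> #|X2| = N2 ->
    exists (S : finType) (X : {set (n1 + n2).-tuple S}),
      FPA lam (minn a b) X /\ #|X| = N1 * N2)
  /\
  (forall n : nat, ~~ odd n -> lam %| n ->
    (forall (N1 N2 : nat) (S1 S2 : finType)
        (X1 : {set n.-tuple S1}) (X2 : {set n.-tuple S2}),
      FPA lam (n %/ 2) X1 -> #|X1| = N1 ->
      FPA lam (n %/ 2) X2 -> #|X2| = N2 ->
      exists (S : finType) (X : {set (2 * n).-tuple S}),
        FPA lam (n %/ 2) X /\ #|X| = N1 * N2)
    /\ M lam n (n %/ 2) ^ 2 <= M lam (2 * n) (n %/ 2)).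
Proof.
have product : forall (n1 n2 a b N1 N2 : nat) (S1 S2 : finType)
    (X1 : {set n1.-tuple S1}) (X2 : {set n2.-tuple S2}),
    FPA lam a X1 -> #|X1| = N1 -> FPA lam b X2 -> #|X2| = N2 ->
    exists (S : finType) (X : {set (n1 + n2).-tuple S}),
      FPA lam (minn a b) X /\ #|X| = N1 * N2.
  move=> n1 n2 a b _ _ S1 S2 X1 X2 F1 <- F2 <-.
  exists (S1 + S2)%type, (sum_cat @: setX X1 X2).
  by split; [exact: FPA_sum_cat | exact: card_sum_cat].
(* The length [2 * n] must become [n + n] for the tuple types to match those of [product]. *)
split=> // n _ lamn; rewrite mul2n -addnn; split.
  move=> N1 N2 S1 S2 X1 X2 F1 c1 F2 c2.
  by rewrite -[n %/ 2]minnn; exact: product F1 c1 F2 c2.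
(* A single optimal array serves as both factors. *)
have [X FX cX] := M_attained (n %/ 2) lam_gt0 lamn.
have [S [Y [FY cY]]] := product _ _ _ _ _ _ _ _ _ _ FX cX FX cX.
(* [Y] lives on some symbol type [S], whereas [M] ranges over arrays on ordinals; [FPA_leq_M]
   bridges the two. *)
by rewrite -mulnn -cY -[n %/ 2]minnn; exact: FPA_leq_M FY.
Qed.
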